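(* Let $X\in\mathbb{E}$. Then (1) $X\star 1$ is intuitionistic, $X\preceq X\star 1$, and for every intuitionistic $X'\in\mathbb{E}$ with $X\preceq X'$ we have $X\star 1\preceq X'$; (2) $1\mathbin{-\!\!\star}X$ is intuitionistic, $1\mathbin{-\!\!\star}X\preceq X$, and for every intuitionistic $X'\in\mathbb{E}$ with $X'\preceq X$ we have $X'\preceq 1\mathbin{-\!\!\star}X$.
   Context: States are pairs $(s,h)$ of a stack $s:\mathrm{Vars}\to\mathbb{Z}$ and a heap $h$, i.e. a map $h:N\to\mathbb{Z}$ with $N=\mathrm{dom}(h)\subseteq\mathbb{N}_{>0}$ finite; $\Sigma$ is the set of states. Heaps $h_1,h_2$ are disjoint ($h_1\perp h_2$) if their domains are, and $h_1\star h_2$ is then their union; $h\subseteq h'$ means $h'=h\star h''$ for some $h''\perp h$. $\mathbb{E}$ is the set of functions $\Sigma\to\mathbb{R}_{\ge0}\cup\{\infty\}$ ordered pointwise by $\preceq$ (with $0\cdot\infty=0$); $1$ is the constant function $1$ (the indicator of the predicate $\mathsf{true}$). $(X\star Y)(s,h)=\max\{X(s,h_1)\cdot Y(s,h_2)\mid h=h_1\star h_2\}$ and, for a predicate $\varphi$ with indicator $[\varphi]$, $([\varphi]\mathbin{-\!\!\star}X)(s,h)=\inf\{X(s,h\star h')\mid h'\perp h,\ (s,h')\models\varphi\}$ (so $(1\mathbin{-\!\!\star}X)(s,h)=\inf\{X(s,h\star h')\mid h'\perp h\}$). An expectation $X$ is intuitionistic if $X(s,h)\le X(s,h')$ whenever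 $h\subseteq h'$. *)

(* Defs.v *)
From HB Require Import structures.
From mathcomp Require Import all_boot all_order all_algebra.
From mathcomp Require Import finmap.
From mathcomp Require Import all_classical all_reals.
From mathcomp Require Import ereal numfun.

Set Implicit Arguments.
Unset Strict Implicit.
Unset Printing Implicit Defensive.

Import Order.TTheory GRing.Theory Num.Theory.

Local Open Scope classical_set_scope.
Local Open Scope ring_scope.

Definition stack (Vars : Type) : Type := Vars -> int.

Definition addr : Type := {n : nat | (0 < n)%N}.

Definition heap : Type := {fmap addr -> int}.

Definition state (Vars : Type) : Type := (stack Vars * heap)%type.

Definition hdisjoint (h1 h2 : heap) : Prop :=
  [disjoint domf h1 & domf h2]%fset.

(* Union of heaps. [catf] is total and right-biased on overlaps, so [hunion] is
   only meaningful, and only used below, on disjoint heaps. *)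
Definition hunion (h1 h2 : heap) : heap := catf h1 h2.

Definition hsub (h h' : heap) : Prop :=
  exists h'' : heap, hdisjoint h h'' /\ h' = hunion h h''.

Section Expectations.
Context {R : realType} {Vars : Type}.
Local Open Scope ereal_scope.

Record expectation : Type := Expectation {
  expect_fun :> state Vars -> \bar R ;
  expect_ge0 : forall sh, 0 <= expect_fun sh }.

Definition expect_le (X Y : expectation) : Prop := forall sh, X sh <= Y sh.

Definition intuitionistic (X : expectation) : Prop :=
  forall (s : stack Vars) (h h' : heap), hsub h h' -> X (s, h) <= X (s, h').

Definition expect_one : expectation :=
  @Expectation (fun=> 1) (fun=> @lee01 R).

Program Definition iverson (phi : set (state Vars)) : expectation :=
  @Expectation (fun sh => (\1_phi sh)%:E) _.
Next Obligation. by move=> phi sh; rewrite lee_fin. Qed.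

Lemma iversonT : expect_fun (iverson setT) = expect_fun expect_one.
Proof. by apply/funext => sh /=; rewrite indicT. Qed.

Definition star_values (X Y : expectation) (s : stack Vars) (h : heap) :
    set (\bar R) :=
  [set v | exists h1 h2 : heap, [/\ hdisjoint h1 h2, h = hunion h1 h2 &
                                    v = X (s, h1) * Y (s, h2)]].

(* The defining maximum is written as a supremum; [star_max] below shows that it
   is attained, since a finite heap has finitely many splittings. *)
Definition star_fun (X Y : expectation) (sh : state Vars) : \bar R :=
  ereal_sup (star_values X Y sh.1 sh.2).

Lemma star_values_neq0 (X Y : expectation) s h : star_values X Y s h !=set0.
Proof.
exists (X (s, h) * Y (s, [fmap]%fmap)), h, [fmap]%fmap; split => //.
- by rewrite /hdisjoint fdisjointX0.
- by rewrite /hunion catf0.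
Qed.

Lemma star_ge0 (X Y : expectation) sh : 0 <= star_fun X Y sh.
Proof.
have [v Hv] := star_values_neq0 X Y sh.1 sh.2.
apply: (@le_trans _ _ v); last exact: ereal_sup_ubound.
by case: Hv => h1 [h2 [_ _ ->]]; apply: mule_ge0; apply: expect_ge0.
Qed.

Definition star (X Y : expectation) : expectation :=
  @Expectation (star_fun X Y) (star_ge0 X Y).

Lemma star_max (X Y : expectation) s h :
  star_values X Y s h (star X Y (s, h)) /\
  forall v, star_values X Y s h v -> v <= star X Y (s, h).
Proof.
split; last by move=> v Hv; exact: ereal_sup_ubound.
pose F (A : {fset addr}) := X (s, h.[& A]%fmap) * Y (s, h.[\ A]%fmap).
have sub v : star_values X Y s h v ->
    exists2 A, A \in enum_fset (fpowerset (domf h)) & v = F A.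
  case=> h1 [h2 [d12 eh ->]]; exists (domf h1).
    have : domf h1 \in fpowerset (domf h).
      rewrite fpowersetE eh; apply/fsubsetP => k kh.
      by rewrite /hunion mem_catf kh.
    by [].
  rewrite /F eh /hunion; congr (X (s, _) * Y (s, _)); apply/fmapP => k.
  - rewrite fnd_restrict fnd_cat; case: ifPn => kh1; last exact: not_fnd.
    by move/fdisjointP/(_ _ kh1)/negbTE : d12 => ->.
  - rewrite fnd_rem fnd_cat; case: ifPn => kh1.
      by rewrite not_fnd //; move/fdisjointP/(_ _ kh1) : d12.
    by case: ifPn => // kh2; rewrite !not_fnd.
have mx (l : seq {fset addr}) (V : set (\bar R)) : V !=set0 ->
    (forall v, V v -> exists2 A, A \in l & v = F A) ->
    exists2 v, V v & forall w, V w -> w <= v.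
  elim: l V => [|A l IH] V [v0 Vv0] Vl; first by have [] := Vl _ Vv0.
  have [[v1 [Vv1 n1]]|no] := pselect (exists v, V v /\ v != F A); last first.
    exists v0 => // w Vw.
    have all v : V v -> v = F A.
      by move=> Vv; apply: contrapT => /eqP nv; apply: no; exists v.
    by rewrite (all _ Vw) (all _ Vv0).
  have [||v [Vv nv] maxv] := IH [set v | V v /\ v != F A].
  - by exists v1.
  - move=> v [Vv nv]; have [B] := Vl _ Vv.
    rewrite in_cons => /orP[/eqP -> vE|Bl vE]; last by exists B.
    by rewrite vE eqxx in nv.
  have [VA|nVA] := pselect (V (F A)); last first.
    exists v => // w Vw; apply: maxv; split => //.
    by apply/eqP => wE; apply: nVA; rewrite -wE.
  have [leA|leA] := leP v (F A); [exists (F A) => //|exists v => //] => w Vw;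
    (have [->|nw] := eqVneq w (F A); first by rewrite // ltW).
  - by apply: le_trans leA; apply: maxv.
  - by apply: maxv.
have [v Vv maxv] := mx _ _ (star_values_neq0 X Y s h) sub.
suff -> : star X Y (s, h) = v by [].
apply/eqP; rewrite eq_le; apply/andP; split; last exact: ereal_sup_ubound.
exact: ge_ereal_sup.
Qed.

(* The wand takes the predicate [phi] in place of its indicator [iverson phi];
   with [phi := setT] this is [1 -* X], see [iversonT]. The infimum over the
   empty set is [+oo]. *)
Definition wand_fun (phi : set (state Vars)) (X : expectation)
    (sh : state Vars) : \bar R :=
  ereal_inf [set v | exists h' : heap, [/\ hdisjoint h' sh.2, phi (sh.1, h') &
                                           v = X (sh.1, hunion sh.2 h')]].

Lemma wand_ge0 phi (X : expectation) sh : 0 <= wand_fun phi X sh.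
Proof. by apply: le_ereal_inf_tmp => _ [h' [_ _ ->]]; apply: expect_ge0. Qed.

Definition wand (phi : set (state Vars)) (X : expectation) : expectation :=
  @Expectation (wand_fun phi X) (wand_ge0 phi X).

End Expectations.

Arguments expectation : clear implicits.

(* Main.v *)
From mathcomp Require Import all_order finmap ereal.
Require Import Defs.
From mathcomp Require Import all_boot all_classical all_reals.

Import Order.TTheory.

(** Multiplying by 1 turns [star X expect_one] at h into the supremum of X over the subheaps of h,
    while [wand setT X] is the infimum of X over the extensions of h. Enlarging h gives more
    subheaps and fewer extensions, so both are intuitionistic (by [hunionA]). Since h is its own
    subheap and extension, via the empty heap, X lies between them. An intuitionistic bound of X
    transfers along each inclusion. *)

Lemma hdisjoint_sym (h1 h2 : heap) : hdisjoint h1 h2 -> hdisjoint h2 h1.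
Proof. by rewrite /hdisjoint fdisjoint_sym. Qed.

Lemma hdisjoint0 (h : heap) : hdisjoint h [fmap]%fmap.
Proof. by rewrite /hdisjoint fdisjointX0. Qed.

Lemma hunion0 (h : heap) : hunion h [fmap]%fmap = h.
Proof. by rewrite /hunion catf0. Qed.

Lemma hunionA (h1 h2 h3 : heap) :
  hunion h1 (hunion h2 h3) = hunion (hunion h1 h2) h3.
Proof. by rewrite /hunion catfA. Qed.

Lemma hdisjoint_hunionl (h1 h2 h3 : heap) :
  hdisjoint (hunion h1 h2) h3 <-> hdisjoint h1 h3 /\ hdisjoint h2 h3.
Proof. by rewrite /hdisjoint domf_cat fdisjointUX; split=> /andP. Qed.

Lemma hdisjoint_hunionr (h1 h2 h3 : heap) :
  hdisjoint h1 (hunion h2 h3) <-> hdisjoint h1 h2 /\ hdisjoint h1 h3.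
Proof. by rewrite /hdisjoint domf_cat fdisjointXU; split=> /andP. Qed.

Section IntuitionisticHullKernel.
Context {R : realType} {Vars : Type}.
Implicit Types X Y : expectation R Vars.
Local Open Scope ereal_scope.

(** Every value in the supremum at the smaller heap recurs at the larger one. *)
Lemma star_one_intuitionistic X : intuitionistic (star X expect_one).
Proof.
move=> s h _ [h'' [dh ->]]; apply: ge_ereal_sup => _ /= [h1 [h2 [d12 hE ->]]].
move: dh; rewrite hE => /hdisjoint_hunionl[d1 d2].
(* The added heap joins the part weighted by 1, leaving the product unchanged. *)
apply: ereal_sup_ubound; exists h1, (hunion h2 h''); split=> //=.
- exact/hdisjoint_hunionr.
- by rewrite -hunionA.
Qed.

Lemma le_star_one X : expect_le X (star X expect_one).
Proof.
move=> [s h]; apply: ereal_sup_ubound; exists h, [fmap]%fmap; split=> /=.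
- exact: hdisjoint0.
- by rewrite hunion0.
- by rewrite mule1.
Qed.

(** For a splitting of h into h1 and h2: X(s,h1) <= Y(s,h1) <= Y(s,h). *)
Lemma star_one_least X Y :
  intuitionistic Y -> expect_le X Y -> expect_le (star X expect_one) Y.
Proof.
move=> iY leXY [s h]; apply: ge_ereal_sup => _ /= [h1 [h2 [d12 -> ->]]].
by rewrite mule1; apply: le_trans (leXY _) _; apply: iY; exists h2.
Qed.

(** Extending h * h'' by k is extending h by h'' * k, so the infimum at the larger heap runs over
    fewer values. *)
Lemma wand_true_intuitionistic X : intuitionistic (wand setT X).
Proof.
move=> s h _ [h'' [dh ->]]; apply: le_ereal_inf_tmp => _ /= [k [dk _ ->]].
move/hdisjoint_hunionr: dk => [dkh dkh''].
apply: ereal_inf_lbound; exists (hunion h'' k); split=> //=.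
- by apply/hdisjoint_hunionl; split=> //; exact: hdisjoint_sym.
- by rewrite hunionA.
Qed.

Lemma wand_true_le X : expect_le (wand setT X) X.
Proof.
move=> [s h]; apply: ereal_inf_lbound; exists [fmap]%fmap; split=> //=.
- exact/hdisjoint_sym/hdisjoint0.
- by rewrite hunion0.
Qed.

(** For each k disjoint from h: Y(s,h) <= Y(s,h * k) <= X(s,h * k). *)
Lemma wand_true_greatest X Y :
  intuitionistic Y -> expect_le Y X -> expect_le Y (wand setT X).
Proof.
move=> iY leYX [s h]; apply: le_ereal_inf_tmp => _ /= [k [dk _ ->]].
apply: le_trans (leYX _); apply: iY; exists k; split=> //.
(* [wand_fun] puts the added heap first in [hdisjoint], [hsub] puts it second. *)
exact: hdisjoint_sym.
Qed.

End IntuitionisticHullKernel.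

Theorem theorem3p12 (R : realType) (Vars : Type) (X : expectation R Vars) :
  (intuitionistic (star X expect_one) /\
   expect_le X (star X expect_one) /\
   (forall X' : expectation R Vars,
      intuitionistic X' -> expect_le X X' -> expect_le (star X expect_one) X')) /\
  (intuitionistic (wand setT X) /\
   expect_le (wand setT X) X /\
   (forall X' : expectation R Vars,
      intuitionistic X' -> expect_le X' X -> expect_le X' (wand setT X))).
Proof.
split; split; [exact: star_one_intuitionistic | split |
               exact: wand_true_intuitionistic | split].
- exact: le_star_one.
- by move=> X'; exact: star_one_least.
- exact: wand_true_le.
- by move=> X'; exact: wand_true_greatest.
Qed.
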